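(* Let $A$ be an ideally amenable Banach algebra and let $I$ be a closed two-sided ideal in $A$ that has the trace extension property. Then the quotient Banach algebra $A/I$ is ideally amenable.
   Context: For a Banach algebra $A$ and a Banach $A$-bimodule $X$ (jointly continuous module operations), the dual $X^*$ is a Banach $A$-bimodule via $\langle x,a\cdot x^*\rangle=\langle x\cdot a,x^*\rangle$ and $\langle x,x^*\cdot a\rangle=\langle a\cdot x,x^*\rangle$. A derivation $D:A\to X$ is a continuous linear map with $D(ab)=a\cdot D(b)+D(a)\cdot b$ for all $a,b\in A$; it is inner if there is $x\in X$ with $D(a)=a\cdot x-x\cdot a$ for all $a\in A$. $H^1(A,X)=\{0\}$ means every derivation $A\to X$ is inner. $A$ is ideally amenable if $H^1(A,J^* )=\{0\}$ for every closed two-sided ideal $J$ of $A$ (a Banach $A$-bimodule under multiplication). A closed two-sided ideal $I$ of $A$ has the trace extension property if every $m\in I^*$ with $a\cdot m=m\cdot a$ for all $a\in A$ can be extended to some $a^*\in A^*$ with $a\cdot a^*=a^*\cdot a$ for all $a\in A$. *)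

(* Defs.v *)
From HB Require Import structures.
From mathcomp Require Import all_boot all_order all_algebra.
From mathcomp Require Import generic_quotient ring_quotient complex.
From mathcomp Require Import all_classical all_reals all_analysis.

Set Implicit Arguments.
Unset Strict Implicit.
Unset Printing Implicit Defensive.

Import Order.TTheory GRing.Theory Num.Theory.
Import numFieldNormedType.Exports.

Local Open Scope classical_set_scope.
Local Open Scope complex_scope.
Local Open Scope ring_scope.
Local Open Scope quotient_scope.

(* Banach algebras are not assumed unital, so the ring structures of MathComp
   cannot be reused for the multiplication. *)
HB.mixin Record CompleteNormedModule_isBanachAlgebra (K : numFieldType) A
    & CompleteNormedModule K A := {
  bmul : A -> A -> A;
  bmulA : associative bmul;
  bmulDl : left_distributive bmul +%R;
  bmulDr : right_distributive bmul +%R;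
  bmulZl : forall (k : K) (a b : A), bmul (k *: a) b = k *: bmul a b;
  bmulZr : forall (k : K) (a b : A), bmul a (k *: b) = k *: bmul a b;
  ler_norm_bmul : forall a b : A, `|bmul a b| <= `|a| * `|b|
}.

#[short(type="banachAlgType")]
HB.structure Definition BanachAlgebra (K : numFieldType) :=
  {A of CompleteNormedModule K A & CompleteNormedModule_isBanachAlgebra K A}.

HB.mixin Record CompleteNormedModule_isBanachBimodule (K : numFieldType)
    (A : banachAlgType K) X & CompleteNormedModule K X := {
  lact : A -> X -> X;
  ract : X -> A -> X;
  lactDl : forall (a b : A) (x : X), lact (a + b) x = lact a x + lact b x;
  lactDr : forall (a : A) (x y : X), lact a (x + y) = lact a x + lact a y;
  lactZl : forall (k : K) (a : A) (x : X), lact (k *: a) x = k *: lact a x;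
  lactZr : forall (k : K) (a : A) (x : X), lact a (k *: x) = k *: lact a x;
  ractDl : forall (x y : X) (a : A), ract (x + y) a = ract x a + ract y a;
  ractDr : forall (x : X) (a b : A), ract x (a + b) = ract x a + ract x b;
  ractZl : forall (k : K) (x : X) (a : A), ract (k *: x) a = k *: ract x a;
  ractZr : forall (k : K) (x : X) (a : A), ract x (k *: a) = k *: ract x a;
  lactA : forall (a b : A) (x : X), lact (bmul a b) x = lact a (lact b x);
  ractA : forall (x : X) (a b : A), ract x (bmul a b) = ract (ract x a) b;
  lractA : forall (a : A) (x : X) (b : A),
    ract (lact a x) b = lact a (ract x b);
  lact_continuous : continuous (fun p : A * X => lact p.1 p.2);
  ract_continuous : continuous (fun p : X * A => ract p.1 p.2)
}.

#[short(type="banachBimodType")]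
HB.structure Definition BanachBimodule (K : numFieldType)
    (A : banachAlgType K) :=
  {X of CompleteNormedModule K X & CompleteNormedModule_isBanachBimodule K A X}.

Section derivations.
Context {K : numFieldType} {A : banachAlgType K} {X : banachBimodType A}.

Definition derivation (D : A -> X) : Prop :=
  [/\ linear D, continuous D &
      forall a b : A, D (bmul a b) = lact a (D b) + ract (D a) b].

Definition inner (D : A -> X) : Prop :=
  exists x : X, forall a : A, D a = lact a x - ract x a.

End derivations.

Definition H1_trivial (K : numFieldType) (A : banachAlgType K)
    (X : banachBimodType A) : Prop :=
  forall D : A -> X, derivation D -> inner D.

HB.mixin Record isClosedIdeal (K : numFieldType) (A : banachAlgType K)
    (S : {pred A}) := {
  closed_idealZ : forall (k : K) (x : A), x \in S -> k *: x \in S;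
  closed_idealMl : forall a x : A, x \in S -> bmul a x \in S;
  closed_idealMr : forall x a : A, x \in S -> bmul x a \in S;
  closed_ideal_closed : closed [set x : A | x \in S]
}.

#[short(type="closedIdeal")]
HB.structure Definition ClosedIdeal (K : numFieldType) (A : banachAlgType K) :=
  {S of GRing.ZmodClosed A S & isClosedIdeal K A S}.

Section bilinear_continuity.
Context {K : numFieldType} {U V W : normedModType K} (f : U -> V -> W).
Hypothesis fDl : forall a b x, f (a + b) x = f a x + f b x.
Hypothesis fDr : forall a x y, f a (x + y) = f a x + f a y.
Hypothesis fZl : forall k a x, f (k *: a) x = k *: f a x.
Hypothesis fZr : forall k a x, f a (k *: x) = k *: f a x.

Let f0l x : f 0 x = 0.
Proof. by rewrite -(scale0r (0 : U)) fZl scale0r. Qed.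
Let f0r a : f a 0 = 0.
Proof. by rewrite -(scale0r (0 : V)) fZr scale0r. Qed.
Let fNl a x : f (- a) x = - f a x.
Proof. by rewrite -scaleN1r fZl scaleN1r. Qed.
Let fNr a x : f a (- x) = - f a x.
Proof. by rewrite -scaleN1r fZr scaleN1r. Qed.

Lemma bilinear_bounded_continuous (M : K) : 0 <= M ->
  (forall a x, `|f a x| <= M * (`|a| * `|x|)) ->
  continuous (fun p : U * V => f p.1 p.2).
Proof.
move=> M0 fM [a0 x0]; apply/cvgrPdist_lt => e e0 /=.
have d1_gt0 : 0 < e / 2 / (M * `|x0| + 1).
  by rewrite !divr_gt0// ltr_wpDl// mulr_ge0.
have d2_gt0 : 0 < e / 2 / (M * (`|a0| + 1) + 1).
  by rewrite !divr_gt0// ltr_wpDl// mulr_ge0// addr_ge0.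
have near1 (d : K) : 0 < d -> \forall p \near (a0, x0), `|a0 - p.1| < d.
  exact: (@cvgr_dist_lt _ _ _ (nbhs (a0, x0)) _ fst a0 cvg_fst).
have near2 (d : K) : 0 < d -> \forall p \near (a0, x0), `|x0 - p.2| < d.
  exact: (@cvgr_dist_lt _ _ _ (nbhs (a0, x0)) _ snd x0 cvg_snd).
have H1 := near1 _ ltr01; have H2 := near1 _ d1_gt0; have H3 := near2 _ d2_gt0.
near=> p.
have -> : f a0 x0 - f p.1 p.2 = f (a0 - p.1) x0 + f p.1 (x0 - p.2).
  by rewrite fDl fDr fNl fNr addrA subrK.
rewrite [e]splitr (le_lt_trans (ler_normD _ _))// ltrD//.
  rewrite (le_lt_trans (fM _ _))// mulrCA.
  have : `|a0 - p.1| < e / 2 / (M * `|x0| + 1) by near: p.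
  rewrite ltr_pdivlMr; last by rewrite ltr_wpDl// mulr_ge0.
  by apply: le_lt_trans; rewrite ler_wpM2l// lerDl.
rewrite (le_lt_trans (fM _ _))// mulrA.
have : `|x0 - p.2| < e / 2 / (M * (`|a0| + 1) + 1) by near: p.
rewrite ltr_pdivlMr; last by rewrite ltr_wpDl// mulr_ge0// addr_ge0.
rewrite mulrC; apply: le_lt_trans; rewrite ler_wpM2r//.
rewrite ler_wpDr// ler_wpM2l//.
have -> : p.1 = a0 - (a0 - p.1) by rewrite subKr.
rewrite (le_trans (ler_normB _ _))// lerD2l ltW//.
by near: p.
Unshelve. all: by end_near. Qed.

Lemma bilinear_continuous_bounded :
  continuous (fun p : U * V => f p.1 p.2) ->
  exists2 M : K, 0 < M & forall a x, `|f a x| <= M * (`|a| * `|x|).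
Proof.
move=> /(_ (0, 0)); rewrite /continuous_at/= f0l => /cvgr0_norm_lt.
move=> /(_ 1 ltr01)[[P Q]/=[]].
move=> /nbhs_norm0P[d1/= d10 dP] /nbhs_norm0P[d2/= d20 dQ] PQ.
exists ((d1 / 2)^-1 * (d2 / 2)^-1).
  by rewrite mulr_gt0// invr_gt0 divr_gt0.
move=> a x; have [->|a0] := eqVneq a 0.
  by rewrite f0l !normr0 mul0r mulr0.
have [->|x0] := eqVneq x 0; first by rewrite f0r !normr0 !mulr0.
pose s := d1 / 2 / `|a|; pose t := d2 / 2 / `|x|.
have s0 : 0 < s by rewrite !divr_gt0// normr_gt0.
have t0 : 0 < t by rewrite !divr_gt0// normr_gt0.
have : `|f (s *: a) (t *: x)| < 1.
  apply: (PQ (s *: a, t *: x)); split => /=.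
    apply: dP; rewrite /= normrZ gtr0_norm// divfK ?normr_eq0//.
    by rewrite gtr_pMr// invf_lt1// ltr1n.
  apply: dQ; rewrite /= normrZ gtr0_norm// divfK ?normr_eq0//.
  by rewrite gtr_pMr// invf_lt1// ltr1n.
rewrite fZl fZr (normrZ s) (normrZ t) (gtr0_norm s0) (gtr0_norm t0) mulrA => /ltW h.
have st0 : 0 < s * t by rewrite mulr_gt0.
rewrite -(ler_pM2l st0) (le_trans h)//.
have sE : s * `|a| = d1 / 2 by rewrite divfK ?normr_eq0.
have tE : t * `|x| = d2 / 2 by rewrite divfK ?normr_eq0.
rewrite [leRHS](_ : _ = (s * `|a|) / (d1 / 2) * (t * `|x| / (d2 / 2))).
  by rewrite sE tE !divff ?mulr1// gt_eqF// divr_gt0.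
rewrite [_ * (`|a| * _)]mulrACA [LHS]mulrACA.
by congr (_ * _); rewrite -mulrA; congr (_ * _); rewrite mulrC.
Qed.

End bilinear_continuity.

Section geometric_cauchy.
Context {K : numFieldType}.
Local Notation h n := ((2^-1 : K) ^+ n).
Hypothesis small : forall e : K, 0 < e -> exists n, h n < e.

Lemma geo_gt0 n : 0 < h n.
Proof. by rewrite exprn_gt0// invr_gt0. Qed.

Lemma geoS n : h n = h n.+1 + h n.+1.
Proof. by rewrite [LHS]splitr exprSr. Qed.

Lemma geo_dist (V : normedModType K) (u : nat -> V) (M : K) : 0 <= M ->
  (forall n, `|u n - u n.+1| <= M * h n) ->
  forall n m, (n <= m)%N -> `|u n - u m| <= M * (h n + h n).
Proof.
move=> M0 uM n m nm; rewrite -(subnKC nm); move: (m - n)%N => k.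
apply: (@le_trans _ _ (M * ((h n + h n) - (h (n + k) + h (n + k))))).
  elim: k => [|k ih]; first by rewrite addn0 !subrr normr0 mulr0.
  rewrite -(subrKA (u (n + k)%N)) (le_trans (ler_normD _ _))//.
  rewrite addnS -geoS.
  have /(lerD ih)/le_trans := uM (n + k)%N; apply.
  by rewrite -mulrDr ler_wpM2l// opprD addrA subrK.
by rewrite ler_wpM2l// gerBl addr_ge0// ltW// geo_gt0.
Qed.

Lemma geo_limit (V : normedModType K) (u : nat -> V) (M : K) (l : V) :
  0 <= M -> (forall n, `|u n - u n.+1| <= M * h n) -> u @ \oo --> l ->
  forall n, `|u n - l| <= M * (h n + h n).
Proof.
move=> M0 uM ul n; apply/ler_addgt0Pr => e e0.
have /cvgrPdist_lt/(_ _ e0)[N _ HN] := ul.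
rewrite -(subrKA (u (maxn n N))) (le_trans (ler_normD _ _))// lerD//.
  by apply: geo_dist => //; exact: leq_maxl.
by rewrite distrC ltW//; apply: HN; exact: leq_maxr.
Qed.

Lemma geo_cvg (V : completeNormedModType K) (u : nat -> V) (M : K) : 0 < M ->
  (forall n, `|u n - u n.+1| <= M * h n) -> cvg (u @ \oo).
Proof.
move=> M0 uM; apply: cauchy_cvg; apply/cauchyP => e e0.
have [n nE] := small (divr_gt0 (divr_gt0 e0 M0) (ltr0n _ 2)).
exists (u n); exists n => // m /= nm.
rewrite -ball_normE /= (le_lt_trans (geo_dist (ltW M0) uM nm))//.
by rewrite mulrC -ltr_pdivlMr// [ltRHS]splitr ltrD.
Qed.

Lemma geo_complete (V : normedModType K) :
  (forall u : nat -> V, (forall n, `|u n - u n.+1| <= h n) ->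
     exists l : V, u @ \oo --> l) ->
  forall F : set_system V, ProperFilter F -> cauchy F -> cvg F.
Proof.
move=> Vcvg F FF /cauchyP Fc.
have /choice[y yF] : forall n, exists y : V, F (ball y (h n.+1)).
  by move=> n; apply: Fc; exact: geo_gt0.
have [|l yl] := Vcvg y.
  move=> n; have [z [/= z1 z2]] := filter_ex (filterI (yF n) (yF n.+1)).
  move: z1 z2; rewrite -!ball_normE/= => z1 z2.
  rewrite -(subrKA z) (le_trans (ler_normD _ _))// (geoS n) lerD// ltW//.
  rewrite distrC (lt_le_trans z2)// [leRHS]geoS lerDl ltW//; exact: geo_gt0.
apply/cvg_ex; exists l; apply/cvgrPdist_lt => e e0.
have e20 : 0 < e / 2 by rewrite divr_gt0.
have [N NE] := small e20.
have /cvgrPdist_lt/(_ _ e20)[N1 _ HN1] := yl.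
pose n := maxn N N1.
apply: filterS (yF n) => z; rewrite -ball_normE/= => zn.
rewrite [e]splitr -(subrKA (y n)) (le_lt_trans (ler_normD _ _))// ltrD//.
  by apply: HN1; rewrite /= leq_maxr.
rewrite (lt_trans zn)// (le_lt_trans _ NE)//.
rewrite ler_wiXn2l ?invr_ge0 ?invf_le1 ?ler1n//.
by rewrite (leq_trans (leq_maxl N N1)).
Qed.

End geometric_cauchy.

Section complex_norm.
Context {R : realType}.
Local Notation C := R[i].

Lemma real_geo_small (e : R) : 0 < e -> exists n, (2^-1 : R) ^+ n < e.
Proof.
move=> e0; have h1 : `|2^-1 : R| < 1.
  by rewrite ger0_norm ?invr_ge0// invf_lt1// ltr1n.
have /cvgr0_norm_lt/(_ e e0)[n _ /(_ n (leqnn n))] := cvg_expr h1.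
by rewrite /= ger0_norm ?exprn_ge0 ?invr_ge0//; exists n.
Qed.

Lemma complex_geoE n : ((2^-1 : C) ^+ n) = ((2^-1 : R) ^+ n)%:C.
Proof. by rewrite rmorphXn/= fmorphV rmorph_nat. Qed.

Lemma complex_geo_small (e : C) : 0 < e -> exists n, (2^-1 : C) ^+ n < e.
Proof.
move=> e0; rewrite -(RRe_real (gtr0_real e0)).
have /real_geo_small[n nE] : 0 < complex.Re e.
  by rewrite -ltcR (RRe_real (gtr0_real e0)).
by exists n; rewrite complex_geoE ltcR.
Qed.

Lemma normc_ge_Im (z : C) : `|complex.Im z|%:C <= `|z|.
Proof. by rewrite normc_def lecR -sqrtr_sqr ler_wsqrtr// lerDr sqr_ge0. Qed.

Lemma normc_le_ReIm (z : C) :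
  `|z| <= (`|complex.Re z| + `|complex.Im z|)%:C.
Proof.
rewrite normc_def lecR -[leRHS]ger0_norm ?addr_ge0// -sqrtr_sqr ler_wsqrtr//.
by rewrite sqrrD !real_normK ?num_real// lerD2r lerDl mulrn_wge0// mulr_ge0.
Qed.

Lemma complex_geo_cvg (u : nat -> C^o) (M : C) : 0 < M ->
  (forall n, `|u n - u n.+1| <= M * (2^-1) ^+ n) ->
  exists l : C^o, u @ \oo --> l.
Proof.
move=> M0 ustep; have ME := RRe_real (gtr0_real M0).
have step (p : C -> R) : {morph p : x y / x - y} ->
    (forall z, `|p z|%:C <= `|z|) -> cvg ((p \o u : nat -> R^o) @ \oo).
  move=> pB pn; have M0' : 0 < complex.Re M by rewrite -ltcR ME.
  apply: (geo_cvg real_geo_small M0') => n /=.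
  by rewrite -pB -lecR rmorphM/= ME -complex_geoE (le_trans (pn _)).
have ReB : {morph @complex.Re R : x y / x - y} by move=> [a b] [c d].
have ImB : {morph @complex.Im R : x y / x - y} by move=> [a b] [c d].
have /cvg_ex[a ua] := step _ ReB (@normc_ge_Re R).
have /cvg_ex[b ub] := step _ ImB normc_ge_Im.
exists (a +i* b); apply/cvgrPdist_lt => e e0.
have eE := RRe_real (gtr0_real e0).
have e20 : 0 < complex.Re e / 2 by rewrite divr_gt0// -ltcR eE.
have /cvgrPdist_lt/(_ _ e20) Ha := ua.
have /cvgrPdist_lt/(_ _ e20) Hb := ub.
near=> n.
rewrite (le_lt_trans (normc_le_ReIm _))// -eE ltcR ReB ImB/=.
rewrite [complex.Re e]splitr ltrD//.
  by near: n.
by near: n.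
Unshelve. all: by end_near. Qed.

End complex_norm.

Section ideal_space.
Context {R : realType} {A : banachAlgType R[i]} (J : closedIdeal A).

(* A dedicated record rather than the sigma type {x | x \in J}, which
   MathComp-Analysis already equips with the initial topology; here the
   topology is the one of the norm inherited from A. *)
Record ideal_elt := IdealElt { ideal_val : A; _ : ideal_val \in J }.

HB.instance Definition _ := [isSub for ideal_val].
HB.instance Definition _ := [Choice of ideal_elt by <:].

Fact ideal_submod_closed : submod_closed J.
Proof.
by split=> [|k x y xJ yJ]; rewrite ?rpred0// rpredD// closed_idealZ.
Qed.

HB.instance Definition _ := GRing.SubChoice_isSubLmodule.Build
  R[i] A _ ideal_elt ideal_submod_closed.

Definition ideal_norm (x : ideal_elt) : R[i] := `|val x|.

Fact ideal_ler_normD x y : ideal_norm (x + y) <= ideal_norm x + ideal_norm y.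
Proof. exact: ler_normD. Qed.
Fact ideal_normrZ (k : R[i]) x : ideal_norm (k *: x) = `|k| * ideal_norm x.
Proof. exact: normrZ. Qed.
Fact ideal_normr0_eq0 x : ideal_norm x = 0 -> x = 0.
Proof. by move=> /normr0_eq0 x0; exact: val_inj. Qed.

HB.instance Definition _ := Lmodule_isNormed.Build R[i] ideal_elt
  ideal_ler_normD ideal_normrZ ideal_normr0_eq0.

Lemma ideal_normE (x : ideal_elt) : `|x| = `|val x|.
Proof. by []. Qed.

Fact ideal_complete (F : set_system ideal_elt) :
  ProperFilter F -> cauchy F -> cvg F.
Proof.
apply: (geo_complete complex_geo_small) => u ustep.
have /cvg_ex[l ul] : cvg ((val \o u : nat -> A) @ \oo).
  apply: (geo_cvg complex_geo_small ltr01) => n.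
  by rewrite mul1r; exact: ustep.
have lJ : l \in J.
  apply: (closed_cvg (fun x : A => x \in J) _ _ l ul); first exact: closed_ideal_closed.
  by apply: nearW => n; exact: valP.
exists (IdealElt lJ); apply/cvgrPdist_lt => e e0.
have /cvgrPdist_lt/(_ _ e0) := ul.
exact.
Qed.

HB.instance Definition _ := Uniform_isComplete.Build ideal_elt ideal_complete.

Definition ideal_lact (a : A) (x : ideal_elt) : ideal_elt :=
  IdealElt (closed_idealMl a _ (valP x)).
Definition ideal_ract (x : ideal_elt) (a : A) : ideal_elt :=
  IdealElt (closed_idealMr _ a (valP x)).

Fact ideal_lactDl a b x : ideal_lact (a + b) x = ideal_lact a x + ideal_lact b x.
Proof. by apply: val_inj; rewrite /= bmulDl. Qed.
Fact ideal_lactDr a x y : ideal_lact a (x + y) = ideal_lact a x + ideal_lact a y.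
Proof. by apply: val_inj; rewrite /= bmulDr. Qed.
Fact ideal_lactZl k a x : ideal_lact (k *: a) x = k *: ideal_lact a x.
Proof. by apply: val_inj; rewrite /= bmulZl. Qed.
Fact ideal_lactZr k a x : ideal_lact a (k *: x) = k *: ideal_lact a x.
Proof. by apply: val_inj; rewrite /= bmulZr. Qed.
Fact ideal_ractDl x y a : ideal_ract (x + y) a = ideal_ract x a + ideal_ract y a.
Proof. by apply: val_inj; rewrite /= bmulDl. Qed.
Fact ideal_ractDr x a b : ideal_ract x (a + b) = ideal_ract x a + ideal_ract x b.
Proof. by apply: val_inj; rewrite /= bmulDr. Qed.
Fact ideal_ractZl k x a : ideal_ract (k *: x) a = k *: ideal_ract x a.
Proof. by apply: val_inj; rewrite /= bmulZl. Qed.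
Fact ideal_ractZr k x a : ideal_ract x (k *: a) = k *: ideal_ract x a.
Proof. by apply: val_inj; rewrite /= bmulZr. Qed.
Fact ideal_lactA a b x : ideal_lact (bmul a b) x = ideal_lact a (ideal_lact b x).
Proof. by apply: val_inj; rewrite /= bmulA. Qed.
Fact ideal_ractA x a b : ideal_ract x (bmul a b) = ideal_ract (ideal_ract x a) b.
Proof. by apply: val_inj; rewrite /= bmulA. Qed.
Fact ideal_lractA a x b :
  ideal_ract (ideal_lact a x) b = ideal_lact a (ideal_ract x b).
Proof. by apply: val_inj; rewrite /= bmulA. Qed.
Fact ideal_lact_continuous :
  continuous (fun p : A * ideal_elt => ideal_lact p.1 p.2).
Proof.
apply: (bilinear_bounded_continuous ideal_lactDl ideal_lactDr ideal_lactZl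
  ideal_lactZr (@ler01 R[i])) => a x.
by rewrite mul1r !ideal_normE ler_norm_bmul.
Qed.
Fact ideal_ract_continuous :
  continuous (fun p : ideal_elt * A => ideal_ract p.1 p.2).
Proof.
apply: (bilinear_bounded_continuous ideal_ractDl ideal_ractDr ideal_ractZl
  ideal_ractZr (@ler01 R[i])) => x a.
by rewrite mul1r !ideal_normE ler_norm_bmul.
Qed.

HB.instance Definition _ := CompleteNormedModule_isBanachBimodule.Build
  R[i] A ideal_elt ideal_lactDl ideal_lactDr ideal_lactZl ideal_lactZr
  ideal_ractDl ideal_ractDr ideal_ractZl ideal_ractZr ideal_lactA ideal_ractA
  ideal_lractA ideal_lact_continuous ideal_ract_continuous.

End ideal_space.

(* An alias of A carrying the bimodule structure given by multiplication. *)
Definition regular_bimod (K : numFieldType) (A : banachAlgType K) : Type := A.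

Section regular_bimodule.
Context {K : numFieldType} {A : banachAlgType K}.
Local Notation X := (regular_bimod A).

HB.instance Definition _ := CompleteNormedModule.copy X A.

Fact regular_bmul_continuous : continuous (fun p : A * A => bmul p.1 p.2).
Proof.
apply: (@bilinear_bounded_continuous _ _ _ _ bmul _ _ _ _ 1 ler01).
- exact: bmulDl.
- exact: bmulDr.
- exact: bmulZl.
- exact: bmulZr.
- by move=> a x; rewrite mul1r ler_norm_bmul.
Qed.

HB.instance Definition _ := CompleteNormedModule_isBanachBimodule.Build
  K A X bmulDl bmulDr bmulZl bmulZr bmulDl bmulDr bmulZl bmulZr
  (fun a b x => esym (bmulA a b x)) (fun x a b => bmulA x a b)
  (fun a x b => esym (bmulA a x b))
  regular_bmul_continuous regular_bmul_continuous.

End regular_bimodule.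

Section continuous_dual.
Context {R : realType} (X : normedModType R[i]).
Local Notation C := R[i].

Record dual_space := Dual {
  dual_fun :> X -> C^o;
  _ : `[< linear dual_fun /\ continuous dual_fun >]
}.

HB.instance Definition _ := [isSub for dual_fun].
HB.instance Definition _ := [Choice of dual_space by <:].

Lemma dual_linear (f : dual_space) : linear f.
Proof. by case: f => f /= /asboolP[]. Qed.

Lemma dual_continuous (f : dual_space) : continuous f.
Proof. by case: f => f /= /asboolP[]. Qed.

HB.instance Definition _ (f : dual_space) :=
  GRing.isLinear.Build C X C^o *:%R f (dual_linear f).

Fact dual_submod_closed :
  submod_closed [pred f : X -> C^o | `[< linear f /\ continuous f >]].
Proof.
split; first by apply/asboolP; split=> [k x y|x] /=;
  [rewrite scaler0 addr0|exact: cvg_cst].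
move=> k f g /asboolP[fl fc] /asboolP[gl gc]; apply/asboolP; split=> [c x y|x].
  rewrite /= !fctE /= fl gl !scalerDr !scalerA addrACA [k * c]mulrC.
  by rewrite -!scalerA.
by apply: cvgD; [apply: cvgZr; exact: fc|exact: gc].
Qed.

HB.instance Definition _ := GRing.SubChoice_isSubLmodule.Build
  C (X -> C^o) _ dual_space dual_submod_closed.

Lemma dualP (f g : dual_space) : (forall x, f x = g x) -> f = g.
Proof. by move=> fg; apply: val_inj; apply/funext. Qed.

Lemma dual_addE (f g : dual_space) x : (f + g) x = f x + g x.
Proof. by []. Qed.

Lemma dual_scaleE (k : C) (f : dual_space) x : (k *: f) x = k * f x.
Proof. by []. Qed.

(* The norm of a normedModType R[i] takes its (real) values in R[i], whence the
   passage through complex.Re and %:C around the real supremum. *)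
Definition dual_norm (f : dual_space) : C :=
  (sup [set complex.Re `|f x| | x in [set x : X | `|x| <= 1]])%:C.

Fact dual_bounded (f : dual_space) :
  exists2 M : C, 0 < M & forall x, `|f x| <= M * `|x|.
Proof.
have /continuous_linear_bounded : {for 0, continuous f} by exact: dual_continuous.
move=> /(_ 0)/linear_boundedP/pinfty_ex_gt0[M M0 fM].
by exists M.
Qed.

Fact dual_norm_has_ubound (f : dual_space) :
  has_ubound [set complex.Re `|f x| | x in [set x : X | `|x| <= 1]].
Proof.
have [M M0 fM] := dual_bounded f; exists (complex.Re M) => _ [x /= x1 <-].
rewrite -lecR !RRe_real ?normr_real// ?gtr0_real//.
by rewrite (le_trans (fM x))// ger_pMr.
Qed.

Lemma dual_norm_ge0 f : 0 <= dual_norm f.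
Proof.
rewrite ler0c; apply: (@le_trans _ _ (complex.Re `|f 0|)).
  by rewrite -ler0c RRe_real ?normr_real.
by apply: ub_le_sup; [exact: dual_norm_has_ubound|exists 0 => //=; rewrite normr0].
Qed.

Lemma dual_norm_le (f : dual_space) x : `|f x| <= dual_norm f * `|x|.
Proof.
have [->|x0] := eqVneq x 0; first by rewrite linear0 !normr0 mulr0.
have nx0 : 0 < `|x| by rewrite normr_gt0.
rewrite -ler_pdivrMr//.
have -> : `|f x| / `|x| = `|f (`|x|^-1 *: x)|.
  by rewrite linearZ normrZ normfV normr_id mulrC.
rewrite -[leLHS]RRe_real ?normr_real// lecR.
apply: ub_le_sup; first exact: dual_norm_has_ubound.
by exists (`|x|^-1 *: x) => //=; rewrite normfZV.
Qed.

Lemma dual_norm_min (f : dual_space) (M : C) : 0 <= M ->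
  (forall x, `|f x| <= M * `|x|) -> dual_norm f <= M.
Proof.
move=> M0 fM; rewrite -[leRHS]RRe_real ?ger0_real// lecR.
apply: ge_sup; first by exists (complex.Re `|f 0|), 0 => //=; rewrite normr0.
move=> _ [x /= x1 <-]; rewrite -lecR !RRe_real ?normr_real// ?ger0_real//.
by rewrite (le_trans (fM x))// ler_piMr.
Qed.

Fact dual_ler_normD f g : dual_norm (f + g) <= dual_norm f + dual_norm g.
Proof.
apply: dual_norm_min => [|x]; first by rewrite addr_ge0// dual_norm_ge0.
by rewrite dual_addE mulrDl (le_trans (ler_normD _ _))// lerD// dual_norm_le.
Qed.

Fact dual_normrZ (k : C) f : dual_norm (k *: f) = `|k| * dual_norm f.
Proof.
have le1 (c : C) g : dual_norm (c *: g) <= `|c| * dual_norm g.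
  apply: dual_norm_min => [|x]; first by rewrite mulr_ge0// dual_norm_ge0.
  by rewrite dual_scaleE normrM -mulrA ler_wpM2l// dual_norm_le.
apply/eqP; rewrite eq_le le1/=.
have [->|k0] := eqVneq k 0; first by rewrite normr0 mul0r dual_norm_ge0.
have k0' : 0 < `|k| by rewrite normr_gt0.
have := le1 k^-1 (k *: f); rewrite scalerA mulVf// scale1r normfV.
by rewrite ler_pdivlMl.
Qed.

Fact dual_normr0_eq0 f : dual_norm f = 0 -> f = 0.
Proof.
move=> f0; apply: dualP => x; apply/eqP; rewrite -normr_le0.
by rewrite (le_trans (dual_norm_le _ _))// f0 mul0r.
Qed.

HB.instance Definition _ := Lmodule_isNormed.Build C dual_space
  dual_ler_normD dual_normrZ dual_normr0_eq0.

Lemma dual_normE (f : dual_space) : `|f| = dual_norm f.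
Proof. by []. Qed.

Fact dual_complete (F : set_system dual_space) :
  ProperFilter F -> cauchy F -> cvg F.
Proof.
apply: (geo_complete complex_geo_small) => u ustep.
have step x n : `|u n x - u n.+1 x| <= `|x| * (2^-1 : C) ^+ n.
  have /(ler_wpM2r (normr_ge0 x))/(le_trans (dual_norm_le (u n - u n.+1) x)) :=
    ustep n.
  by rewrite mulrC.
have /choice[f uf] : forall x, exists l : C^o, (fun n => u n x) @ \oo --> l.
  move=> x.
  have x1 : 0 < `|x| + 1 by rewrite ltr_wpDl.
  apply: (complex_geo_cvg x1) => n; rewrite (le_trans (step x n))//.
  by rewrite ler_wpM2r ?lerDl// exprn_ge0// invr_ge0.
have fl : linear f.
  move=> k x y; apply: (norm_cvg_unique (uf (k *: x + y))).
  rewrite (_ : (fun n => u n (k *: x + y)) = (fun n => k *: u n x + u n y));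
    last by apply/funext => n; exact: dual_linear.
  by apply: cvgD; [apply: cvgZr|]; exact: uf.
have dist x n : `|u n x - f x| <= `|x| * ((2^-1 : C) ^+ n + (2^-1 : C) ^+ n).
  exact: (@geo_limit _ C^o (fun n => u n x) _ (f x) (normr_ge0 x)).
have fc : continuous f.
  pose g : {linear X -> C^o} :=
    HB.pack f (GRing.isLinear.Build C X C^o *:%R f fl).
  apply: (@bounded_linear_continuous _ _ _ g); apply/linear_boundedP.
  have [M M0 uM] := dual_bounded (u 0%N).
  exists (M + (1 + 1)); split; first by rewrite gtr0_real// !addr_gt0.
  move=> r /ltW Mr x; rewrite /= (le_trans _ (ler_wpM2r (normr_ge0 x) Mr))//.
  have -> : f x = u 0%N x - (u 0%N x - f x) by rewrite subKr.
  rewrite (le_trans (ler_normB _ _))// mulrDl lerD ?uM//.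
  by rewrite [leRHS]mulrC; exact: (dist x 0%N).
have fP : `[< linear f /\ continuous f >] by apply/asboolP.
exists (Dual fP); apply/cvgrPdist_lt => e e0.
have [N NE] := complex_geo_small (divr_gt0 e0 (ltr0n _ 2)).
exists N => // n /= Nn; rewrite distrC (@le_lt_trans _ _
  ((2^-1 : C) ^+ n + (2^-1 : C) ^+ n))//.
  apply: dual_norm_min => [|x].
    by rewrite addr_ge0// exprn_ge0// invr_ge0.
  by rewrite mulrC; exact: dist.
rewrite [e]splitr (le_lt_trans _ (ltrD NE NE))// lerD//;
  by rewrite ler_wiXn2l ?invr_ge0 ?invf_le1 ?ler1n.
Qed.

HB.instance Definition _ := Uniform_isComplete.Build dual_space dual_complete.

End continuous_dual.

Section dual_bimodule.
Context {R : realType} {A : banachAlgType R[i]} (X : banachBimodType A).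
Local Notation C := R[i].
Local Notation X' := (dual_space X).

Fact lact_continuousr (a : A) : continuous (lact a : X -> X).
Proof.
move=> x; apply: (cvg_comp2 (cvg_cst a) cvg_id (lact_continuous (a, x))).
Qed.

Fact ract_continuousl (a : A) : continuous (fun x : X => ract x a).
Proof.
move=> x; apply: (cvg_comp2 cvg_id (cvg_cst a) (ract_continuous (x, a))).
Qed.

Fact dual_lact_subproof (a : A) (f : X') :
  `[< linear (fun x : X => f (ract x a) : C^o) /\
      continuous (fun x : X => f (ract x a) : C^o) >].
Proof.
apply/asboolP; split=> [k x y|x]; first by rewrite ractDl ractZl dual_linear.
by apply: (@continuous_comp _ _ _ (fun x : X => ract x a) f); [exact: ract_continuousl|exact: dual_continuous].
Qed.

Fact dual_ract_subproof (f : X') (a : A) :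
  `[< linear (fun x : X => f (lact a x) : C^o) /\
      continuous (fun x : X => f (lact a x) : C^o) >].
Proof.
apply/asboolP; split=> [k x y|x]; first by rewrite lactDr lactZr dual_linear.
by apply: (@continuous_comp _ _ _ (lact a : X -> X) f); [exact: lact_continuousr|exact: dual_continuous].
Qed.

(* <x, a . f> = <x . a, f> and <x, f . a> = <a . x, f>. *)
Definition dual_lact (a : A) (f : X') : X' := Dual (dual_lact_subproof a f).
Definition dual_ract (f : X') (a : A) : X' := Dual (dual_ract_subproof f a).

Fact dual_lactDl a b f : dual_lact (a + b) f = dual_lact a f + dual_lact b f.
Proof. by apply: dualP => x; rewrite dual_addE /= ractDr linearD. Qed.
Fact dual_lactDr a f g : dual_lact a (f + g) = dual_lact a f + dual_lact a g.
Proof. exact: dualP. Qed.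
Fact dual_lactZl (k : C) a f : dual_lact (k *: a) f = k *: dual_lact a f.
Proof. by apply: dualP => x; rewrite dual_scaleE /= ractZr linearZ. Qed.
Fact dual_lactZr (k : C) a f : dual_lact a (k *: f) = k *: dual_lact a f.
Proof. exact: dualP. Qed.
Fact dual_ractDl f g a : dual_ract (f + g) a = dual_ract f a + dual_ract g a.
Proof. exact: dualP. Qed.
Fact dual_ractDr f a b : dual_ract f (a + b) = dual_ract f a + dual_ract f b.
Proof. by apply: dualP => x; rewrite dual_addE /= lactDl linearD. Qed.
Fact dual_ractZl (k : C) f a : dual_ract (k *: f) a = k *: dual_ract f a.
Proof. exact: dualP. Qed.
Fact dual_ractZr (k : C) f a : dual_ract f (k *: a) = k *: dual_ract f a.
Proof. by apply: dualP => x; rewrite dual_scaleE /= lactZl linearZ. Qed.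
Fact dual_lactA a b f : dual_lact (bmul a b) f = dual_lact a (dual_lact b f).
Proof. by apply: dualP => x /=; rewrite ractA. Qed.
Fact dual_ractA f a b : dual_ract f (bmul a b) = dual_ract (dual_ract f a) b.
Proof. by apply: dualP => x /=; rewrite lactA. Qed.
Fact dual_lractA a f b :
  dual_ract (dual_lact a f) b = dual_lact a (dual_ract f b).
Proof. by apply: dualP => x /=; rewrite lractA. Qed.

Fact dual_lact_continuous :
  continuous (fun p : A * X' => dual_lact p.1 p.2).
Proof.
have [M M0 rM] := bilinear_continuous_bounded
  (@ractZl _ _ X) (@ractZr _ _ X) (@ract_continuous _ _ X).
apply: (bilinear_bounded_continuous dual_lactDl dual_lactDr dual_lactZl
  dual_lactZr (ltW M0)) => a f.
apply: dual_norm_min => [|x]; first by rewrite !mulr_ge0// ltW.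
rewrite /= (le_trans (dual_norm_le _ _))//.
rewrite (le_trans (ler_wpM2l (dual_norm_ge0 f) (rM x a)))//.
by rewrite dual_normE mulrCA -!mulrA ler_wpM2l ?(ltW M0)// [`|x| * _]mulrC mulrCA.
Qed.

Fact dual_ract_continuous :
  continuous (fun p : X' * A => dual_ract p.1 p.2).
Proof.
have [M M0 lM] := bilinear_continuous_bounded
  (@lactZl _ _ X) (@lactZr _ _ X) (@lact_continuous _ _ X).
apply: (bilinear_bounded_continuous dual_ractDl dual_ractDr dual_ractZl
  dual_ractZr (ltW M0)) => f a.
apply: dual_norm_min => [|x]; first by rewrite !mulr_ge0// ltW.
rewrite /= (le_trans (dual_norm_le _ _))//.
rewrite (le_trans (ler_wpM2l (dual_norm_ge0 f) (lM a x)))//.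
by rewrite dual_normE mulrCA -!mulrA.
Qed.

HB.instance Definition _ := CompleteNormedModule_isBanachBimodule.Build
  C A X' dual_lactDl dual_lactDr dual_lactZl dual_lactZr
  dual_ractDl dual_ractDr dual_ractZl dual_ractZr dual_lactA dual_ractA
  dual_lractA dual_lact_continuous dual_ract_continuous.

Lemma lact_dualE (a : A) (f : X') x : lact a f x = f (ract x a).
Proof. by []. Qed.

Lemma ract_dualE (f : X') (a : A) x : ract f a x = f (lact a x).
Proof. by []. Qed.

End dual_bimodule.

Definition ideally_amenable (R : realType) (A : banachAlgType R[i]) : Prop :=
  forall J : closedIdeal A, H1_trivial (dual_space (ideal_elt J)).

Definition trace_extension_property (R : realType) (A : banachAlgType R[i])
    (I : closedIdeal A) : Prop :=
  forall m : dual_space (ideal_elt I), (forall a : A, lact a m = ract m a) ->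
  exists2 f : dual_space (regular_bimod A),
    forall x : ideal_elt I, f (val x) = m x &
    forall a : A, lact a f = ract f a.

Section quotient_algebra.
Context {R : realType} {A : banachAlgType R[i]} (I : closedIdeal A).
Local Notation C := R[i].

Definition quotient_alg : Type := Quotient.quot I.
Local Notation Q := quotient_alg.

HB.instance Definition _ := Choice.copy Q (Quotient.quot I).
HB.instance Definition _ := EqQuotient.copy Q (Quotient.quot I).
HB.instance Definition _ := GRing.Zmodule.copy Q (Quotient.quot I).

Definition quotient_pi (x : A) : Q := \pi_Q x.
Local Notation pi := quotient_pi.

Lemma quotient_piP (q : Q) : exists x, pi x = q.
Proof. by exists (repr q); rewrite /pi reprK. Qed.

Lemma quotient_pi_eq x y : (pi x == pi y) = (x - y \in I).
Proof. by rewrite Quotient.idealrBE. Qed.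

Lemma quotient_piD x y : pi (x + y) = pi x + pi y.
Proof. exact: (Quotient.pi_add I). Qed.

Lemma quotient_piN x : pi (- x) = - pi x.
Proof. exact: (Quotient.pi_opp I). Qed.

Definition quotient_scale (k : C) (q : Q) : Q := pi (k *: repr q).

Lemma quotient_piZ_subproof k x : pi (k *: x) = quotient_scale k (pi x).
Proof.
apply/eqP; rewrite quotient_pi_eq -scalerBr closed_idealZ// -quotient_pi_eq.
by rewrite /pi reprK.
Qed.

Fact quotient_scalerA k l q :
  quotient_scale k (quotient_scale l q) = quotient_scale (k * l) q.
Proof. by have [x <-] := quotient_piP q; rewrite -!quotient_piZ_subproof scalerA. Qed.
Fact quotient_scale1r q : quotient_scale 1 q = q.
Proof. by have [x <-] := quotient_piP q; rewrite -quotient_piZ_subproof scale1r. Qed.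
Fact quotient_scalerDr : right_distributive quotient_scale +%R.
Proof.
move=> k p q; have [x <-] := quotient_piP p; have [y <-] := quotient_piP q.
by rewrite -quotient_piD -!quotient_piZ_subproof scalerDr quotient_piD.
Qed.
Fact quotient_scalerDl q : {morph quotient_scale^~ q : k l / k + l}.
Proof.
move=> k l; have [x <-] := quotient_piP q.
by rewrite -!quotient_piZ_subproof scalerDl quotient_piD.
Qed.

HB.instance Definition _ := GRing.Zmodule_isLmodule.Build C Q
  quotient_scalerA quotient_scale1r quotient_scalerDr quotient_scalerDl.

Lemma quotient_piZ k x : pi (k *: x) = k *: pi x.
Proof. exact: quotient_piZ_subproof. Qed.

Lemma quotient_piB x y : pi (x - y) = pi x - pi y.
Proof. by rewrite quotient_piD quotient_piN. Qed.

Lemma quotient_pi0P x : (pi x = 0) <-> (x \in I).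
Proof.
have pi0 : pi 0 = 0 by rewrite -(subrr (0 : A)) quotient_piB subrr.
by split=> [|xI]; [move/eqP|apply/eqP]; rewrite -pi0 quotient_pi_eq subr0.
Qed.

Definition quotient_norm (q : Q) : C :=
  (inf [set complex.Re `|x| | x in [set x : A | pi x = q]])%:C.

Fact quotient_norm_has_inf q :
  has_inf [set complex.Re `|x| | x in [set x : A | pi x = q]].
Proof.
split; first by have [x xq] := quotient_piP q; exists (complex.Re `|x|), x.
exists 0 => _ [x _ <-]; by rewrite -ler0c RRe_real ?normr_real.
Qed.

Lemma quotient_norm_le x : quotient_norm (pi x) <= `|x|.
Proof.
rewrite -[leRHS]RRe_real ?normr_real// lecR.
by apply: ge_inf; [case: (quotient_norm_has_inf (pi x))|exists x].
Qed.

Lemma quotient_norm_ge0 q : 0 <= quotient_norm q.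
Proof.
rewrite ler0c; apply: lb_le_inf; first by case: (quotient_norm_has_inf q).
by move=> _ [x _ <-]; rewrite -ler0c RRe_real ?normr_real.
Qed.

Lemma quotient_norm_adherent q (e : C) : 0 < e ->
  exists2 x, pi x = q & `|x| < quotient_norm q + e.
Proof.
move=> e0; have eE := RRe_real (gtr0_real e0).
have e0' : 0 < complex.Re e by rewrite -ltcR eE.
have [_ [x xq <-] xe] := inf_adherent e0' (quotient_norm_has_inf q).
exists x => //; rewrite -eE -rmorphD/= -[ltLHS]RRe_real ?normr_real//.
by rewrite ltcR.
Qed.

Fact quotient_ler_normD p q :
  quotient_norm (p + q) <= quotient_norm p + quotient_norm q.
Proof.
apply/ler_addgt0Pr => e e0; have e20 : 0 < e / 2 by rewrite divr_gt0.
have [x <- xe] := quotient_norm_adherent p e20.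
have [y <- ye] := quotient_norm_adherent q e20.
rewrite -quotient_piD (le_trans (quotient_norm_le _))//.
rewrite (le_trans (ler_normD _ _))// [e]splitr addrACA.
by rewrite lerD ?(ltW xe) ?(ltW ye).
Qed.

Fact quotient_normrZ (k : C) q :
  quotient_norm (k *: q) = `|k| * quotient_norm q.
Proof.
have [->|k0] := eqVneq k 0.
  rewrite normr0 mul0r scale0r; apply/eqP; rewrite eq_le quotient_norm_ge0 andbT.
  by rewrite -(quotient_pi0P 0).2 ?rpred0// -(normr0 A) quotient_norm_le.
have le1 (c : C) p : c != 0 -> quotient_norm (c *: p) <= `|c| * quotient_norm p.
  move=> c0; apply/ler_addgt0Pr => e e0.
  have c0' : 0 < `|c| by rewrite normr_gt0.
  have [x <- xe] := quotient_norm_adherent p (divr_gt0 e0 c0').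
  rewrite -quotient_piZ (le_trans (quotient_norm_le _))// normrZ.
  by rewrite (le_trans (ler_wpM2l (normr_ge0 c) (ltW xe)))// mulrDr mulrC [_ * (e / _)]mulrC divfK ?gt_eqF// mulrC.
apply/eqP; rewrite eq_le le1//=.
have k0' : 0 < `|k| by rewrite normr_gt0.
have := le1 k^-1 (k *: q); rewrite invr_eq0 => /(_ k0).
by rewrite scalerA mulVf// scale1r normfV ler_pdivlMl.
Qed.

Fact quotient_normr0_eq0 q : quotient_norm q = 0 -> q = 0.
Proof.
move=> q0; have [y yq] := quotient_piP q; rewrite -yq; apply/quotient_pi0P.
apply: (closed_ideal_closed (s := I)) => /= B /nbhs_normP[e /= e0 eB].
have [z zq] := quotient_norm_adherent q e0; rewrite q0 add0r => ze.
exists (y - z); split; last by apply: eB; rewrite /= subKr.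
by rewrite /= -quotient_pi0P quotient_piB yq zq subrr.
Qed.

HB.instance Definition _ := Lmodule_isNormed.Build C Q
  quotient_ler_normD quotient_normrZ quotient_normr0_eq0.

Lemma quotient_normE (q : Q) : `|q| = quotient_norm q.
Proof. by []. Qed.

Fact quotient_complete (F : set_system Q) :
  ProperFilter F -> cauchy F -> cvg F.
Proof.
apply: (geo_complete complex_geo_small) => u ustep.
have /choice[s sP] : forall p : Q * nat, exists x : A,
    pi x = p.1 /\ `|x| <= `|p.1| + (2^-1) ^+ p.2.
  move=> [q n] /=; have [x xq /ltW xe] := quotient_norm_adherent q (geo_gt0 n).
  by exists x.
pose x := fix x n : A :=
  if n is m.+1 then x m - s (u m - u m.+1, m) else repr (u 0%N).
have xu n : pi (x n) = u n.
  elim: n => [|n ih] /=; first by rewrite /pi reprK.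
  by rewrite quotient_piB ih (sP _).1 /= subKr.
have /cvg_ex[l xl] : cvg ((x : nat -> A) @ \oo).
  apply: (geo_cvg complex_geo_small (ltr0n _ 2)) => n.
  rewrite /= subKr (le_trans (sP _).2)//= mulr_natl mulr2n lerD2r.
  exact: ustep.
exists (pi l); apply/cvgrPdist_lt => e e0.
have /cvgrPdist_lt/(_ _ e0) := xl; apply: filterS => n; apply: le_lt_trans.
by rewrite -xu -quotient_piB quotient_norm_le.
Qed.

HB.instance Definition _ := Uniform_isComplete.Build Q quotient_complete.

Definition quotient_mul (p q : Q) : Q := pi (bmul (repr p) (repr q)).

Let bmulBl (x y z : A) : bmul (x - y) z = bmul x z - bmul y z.
Proof. by rewrite bmulDl -scaleN1r bmulZl scaleN1r. Qed.
Let bmulBr (x y z : A) : bmul x (y - z) = bmul x y - bmul x z.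
Proof. by rewrite bmulDr -scaleN1r bmulZr scaleN1r. Qed.

Lemma quotient_piM_subproof x y : pi (bmul x y) = quotient_mul (pi x) (pi y).
Proof.
apply/eqP; rewrite quotient_pi_eq.
rewrite -(subrKA (bmul (repr (pi x)) y)) -bmulBl -bmulBr rpredD//.
  by rewrite closed_idealMr// -quotient_pi_eq /pi reprK.
by rewrite closed_idealMl// -quotient_pi_eq /pi reprK.
Qed.

Fact quotient_mulA : associative quotient_mul.
Proof.
move=> p q r; have [x <-] := quotient_piP p; have [y <-] := quotient_piP q.
by have [z <-] := quotient_piP r; rewrite -!quotient_piM_subproof bmulA.
Qed.
Fact quotient_mulDl : left_distributive quotient_mul +%R.
Proof.
move=> p q r; have [x <-] := quotient_piP p; have [y <-] := quotient_piP q.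
have [z <-] := quotient_piP r.
by rewrite -!quotient_piM_subproof -!quotient_piD -quotient_piM_subproof bmulDl.
Qed.
Fact quotient_mulDr : right_distributive quotient_mul +%R.
Proof.
move=> p q r; have [x <-] := quotient_piP p; have [y <-] := quotient_piP q.
have [z <-] := quotient_piP r.
by rewrite -!quotient_piM_subproof -!quotient_piD -quotient_piM_subproof bmulDr.
Qed.
Fact quotient_mulZl (k : C) p q : quotient_mul (k *: p) q = k *: quotient_mul p q.
Proof.
have [x <-] := quotient_piP p; have [y <-] := quotient_piP q.
by rewrite -quotient_piZ -!quotient_piM_subproof bmulZl quotient_piZ.
Qed.
Fact quotient_mulZr (k : C) p q : quotient_mul p (k *: q) = k *: quotient_mul p q.
Proof.
have [x <-] := quotient_piP p; have [y <-] := quotient_piP q.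
by rewrite -quotient_piZ -!quotient_piM_subproof bmulZr quotient_piZ.
Qed.
Fact quotient_ler_norm_mul (p q : Q) : `|quotient_mul p q| <= `|p| * `|q|.
Proof.
apply/ler_addgt0Pr => d d0; set a := `|p|; set b := `|q|.
have a0 : 0 <= a by exact: quotient_norm_ge0.
have b0 : 0 <= b by exact: quotient_norm_ge0.
have K0 : 0 < a + b + 1 by rewrite ltr_wpDl// addr_ge0.
pose t := a + b + 1 + d.
have t0 : 0 < t by rewrite addr_gt0.
pose e := d / t.
have e0 : 0 < e by rewrite divr_gt0.
have e1 : e <= 1 by rewrite ler_pdivrMr// mul1r lerDr ltW.
have [x xp /ltW xe] := quotient_norm_adherent p e0.
have [y yq /ltW ye] := quotient_norm_adherent q e0.
rewrite -xp -yq -quotient_piM_subproof quotient_normE.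
rewrite (le_trans (quotient_norm_le _))// (le_trans (ler_norm_bmul _ _))//.
rewrite (le_trans (ler_pM _ _ xe ye))// -!quotient_normE -/a -/b.
rewrite mulrDl !mulrDr -addrA lerD2l.
rewrite [a * e]mulrC -!mulrDr addrA.
rewrite (@le_trans _ _ (e * t))//.
  by rewrite ler_wpM2l ?(ltW e0)// /t -[leRHS]addrA lerD2l ler_wpDr// ltW.
by rewrite /e divfK// gt_eqF.
Qed.

HB.instance Definition _ := CompleteNormedModule_isBanachAlgebra.Build C Q
  quotient_mulA quotient_mulDl quotient_mulDr quotient_mulZl quotient_mulZr
  quotient_ler_norm_mul.

Lemma quotient_piM x y : pi (bmul x y) = bmul (pi x) (pi y).
Proof. exact: quotient_piM_subproof. Qed.

End quotient_algebra.

(* Main.v *)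
Require Import Defs.
From HB Require Import structures.
From mathcomp Require Import all_boot all_order all_algebra.
From mathcomp Require Import complex.
From mathcomp Require Import all_classical all_reals all_analysis.

(* Pull K back to the closed ideal J = pi^-1(K) of A, which contains I. A
   derivation D : A/I -> K^* lifts to the derivation a |-> D(pi a) o pi of A
   into J^*, which is implemented by some m in J^*. As the lift vanishes on I,
   m is a trace on I; extending m|_I to a trace f on A and replacing m by
   m - f|_J leaves the lift unchanged, but now m - f|_J vanishes on I, so it
   descends to a functional on K implementing D. *)

Set Implicit Arguments.
Unset Strict Implicit.
Unset Printing Implicit Defensive.

Import Order.TTheory GRing.Theory Num.Theory.
Import numFieldNormedType.Exports.

Local Open Scope classical_set_scope.
Local Open Scope complex_scope.
Local Open Scope ring_scope.

Section linear_bounded.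
Context {R : realType} {V W : normedModType R[i]}.

Lemma linear_bounded_continuous (f : V -> W) (M : R[i]) : 0 <= M -> linear f ->
  (forall x, `|f x| <= M * `|x|) -> continuous f.
Proof.
move=> M0 fl fM.
pose g : {linear V -> W} :=
  HB.pack f (GRing.isLinear.Build R[i] V W *:%R f fl).
apply: (@bounded_linear_continuous _ _ _ g); apply/linear_boundedP.
(* In [R[i]], [0 <= M] forces [M] to be real, as a bound near infinity must be. *)
exists M; split; first by rewrite ger0_real.
move=> r /ltW Mr x.
by rewrite /= (le_trans (fM x))// ler_wpM2r.
Qed.

End linear_bounded.

Section dual_restriction.
Context {R : realType} {X Y : normedModType R[i]}.
Variable f : X -> Y.
Hypotheses (fl : linear f) (f1 : forall x, `|f x| <= `|x|).

Fact contraction_continuous : continuous f.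
Proof.
by apply: (linear_bounded_continuous ler01 fl) => x; rewrite mul1r.
Qed.

Fact dual_pullback_subproof (g : dual_space Y) :
  `[< linear (g \o f : X -> R[i]^o) /\ continuous (g \o f : X -> R[i]^o) >].
Proof.
apply/asboolP; split=> [k x y|x]; first by rewrite /= fl dual_linear.
by apply: continuous_comp; [exact: contraction_continuous|exact: dual_continuous].
Qed.

(** The adjoint of a linear contraction. It serves for [ideal_pi], for the inclusion of an ideal in
    A, and for that of I in J. *)
Definition dual_pullback (g : dual_space Y) : dual_space X :=
  Dual (dual_pullback_subproof g).

Lemma dual_pullback_linear : linear dual_pullback.
Proof. by move=> k g h; exact: dualP. Qed.

Lemma dual_pullback_norm_le (g : dual_space Y) : `|dual_pullback g| <= `|g|.
Proof.
rewrite !dual_normE; apply: dual_norm_min => [|x]; first exact: dual_norm_ge0.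
by rewrite (le_trans (dual_norm_le g _))// ler_wpM2l ?dual_norm_ge0.
Qed.

End dual_restriction.

Section quotient_pi_continuous.
Context {R : realType} {A : banachAlgType R[i]} (I : closedIdeal A).

Lemma quotient_pi_linear : linear (quotient_pi I).
Proof. by move=> k x y; rewrite quotient_piD quotient_piZ. Qed.

Lemma quotient_pi_norm_le x : `|quotient_pi I x| <= `|x|.
Proof. exact: quotient_norm_le. Qed.

Lemma quotient_pi_continuous : continuous (quotient_pi I).
Proof. exact: contraction_continuous quotient_pi_linear quotient_pi_norm_le. Qed.

End quotient_pi_continuous.

Section preimage_ideal.
Context {R : realType} {A : banachAlgType R[i]} (I : closedIdeal A).
Variable K : closedIdeal (quotient_alg I).
Local Notation pi := (quotient_pi I).

Definition preimage_ideal : {pred A} := [pred x | pi x \in K].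

Fact preimage_ideal_zmod : zmod_closed preimage_ideal.
Proof.
split=> [|x y]; first by rewrite inE (quotient_pi0P I 0).2 ?rpred0.
by rewrite !inE quotient_piB => xK yK; rewrite rpredB.
Qed.

HB.instance Definition _ :=
  GRing.isZmodClosed.Build A preimage_ideal preimage_ideal_zmod.

Fact preimage_idealZ (k : R[i]) (x : A) :
  x \in preimage_ideal -> k *: x \in preimage_ideal.
Proof. by rewrite !inE quotient_piZ; exact: closed_idealZ. Qed.
Fact preimage_idealMl (a x : A) :
  x \in preimage_ideal -> bmul a x \in preimage_ideal.
Proof. by rewrite !inE quotient_piM; exact: closed_idealMl. Qed.
Fact preimage_idealMr (x a : A) :
  x \in preimage_ideal -> bmul x a \in preimage_ideal.
Proof. by rewrite !inE quotient_piM; exact: closed_idealMr. Qed.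
Fact preimage_ideal_closed : closed [set x : A | x \in preimage_ideal].
Proof.
apply: (preimage_closed (D := [set x | x \in K]) (f := pi)).
  by move=> x _; exact: quotient_pi_continuous.
exact: closed_ideal_closed.
Qed.

HB.instance Definition _ := isClosedIdeal.Build R[i] A preimage_ideal
  preimage_idealZ preimage_idealMl preimage_idealMr preimage_ideal_closed.

Local Notation J := (ideal_elt (preimage_ideal : closedIdeal A)).

Fact ideal_pi_subproof (x : J) : pi (val x) \in K.
Proof. exact: valP x. Qed.

Definition ideal_pi (x : J) : ideal_elt K := IdealElt (ideal_pi_subproof x).

Lemma ideal_pi_linear : linear ideal_pi.
Proof. by move=> k x y; apply: val_inj; exact: quotient_pi_linear. Qed.

Lemma ideal_pi_norm_le x : `|ideal_pi x| <= `|x|.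
Proof. exact: quotient_norm_le. Qed.

(** All representatives in A of an element of K lie in J. Hence [ideal_pi] is onto, and a
    representative of almost minimal norm can be taken in J. *)
Lemma ideal_piP (q : ideal_elt K) (x : A) : pi x = val q ->
  exists2 y, val y = x & ideal_pi y = q.
Proof.
move=> xq; have xJ : x \in preimage_ideal by rewrite inE xq (valP q).
by exists (IdealElt xJ) => //; apply: val_inj.
Qed.

Lemma ideal_pi_lact (a : A) x : ideal_pi (lact a x) = lact (pi a) (ideal_pi x).
Proof. by apply: val_inj; exact: quotient_piM. Qed.

Lemma ideal_pi_ract (a : A) x : ideal_pi (ract x a) = ract (ideal_pi x) (pi a).
Proof. by apply: val_inj; exact: quotient_piM. Qed.

(** [ideal_pi] is onto and [m] kills its kernel, so [m] factors through it. The factor has the same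
    bound as [m], because norms in K are infima of norms of representatives, all of them in J. *)
Lemma dual_descend (m : dual_space J) : (forall x, ideal_pi x = 0 -> m x = 0) ->
  exists n : dual_space (ideal_elt K), forall x, n (ideal_pi x) = m x.
Proof.
move=> m0.
have /choice[s sK] : forall q, exists y, ideal_pi y = q.
  move=> q; have [x xq] := quotient_piP (val q).
  by have [y _ yq] := ideal_piP xq; exists y.
have mE x y : ideal_pi x = ideal_pi y -> m x = m y.
  move=> xy; apply/eqP; rewrite -subr_eq0.
  have -> : m x - m y = m (x - y) by rewrite linearB.
  apply/eqP/m0/val_inj/quotient_pi0P.
  by rewrite /= -quotient_pi_eq; apply/eqP; exact: (congr1 val xy).
pose n q : R[i]^o := m (s q).
have nE x : n (ideal_pi x) = m x by apply: mE; rewrite sK.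
have nl : linear n.
  by move=> k p q; rewrite -(sK p) -(sK q) -ideal_pi_linear !nE dual_linear.
have nc : continuous n.
  apply: (linear_bounded_continuous (dual_norm_ge0 m) nl) => q.
  apply/ler_addgt0Pr => e e0.
  (* A representative within [e / (dual_norm m + 1)] of the infimum costs at most [e] once
     multiplied by [dual_norm m]; the [+ 1] covers [m = 0]. *)
  have M0 : 0 < dual_norm m + 1 by rewrite ltr_wpDl ?dual_norm_ge0.
  have [x xq /ltW xe] := quotient_norm_adherent (val q) (divr_gt0 e0 M0).
  have [y yx <-] := ideal_piP xq.
  rewrite nE (le_trans (dual_norm_le m y))// ideal_normE yx.
  rewrite (le_trans (ler_wpM2l (dual_norm_ge0 m) xe))// mulrDr.
  rewrite ideal_normE /= yx xq lerD2l mulrCA ger_pMr// ler_pdivrMr// mul1r.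
  by rewrite lerDl.
have nP : `[< linear n /\ continuous n >] by apply/asboolP.
by exists (Dual nP).
Qed.

Definition ideal_pi_dual : dual_space (ideal_elt K) -> dual_space J :=
  dual_pullback ideal_pi_linear ideal_pi_norm_le.

(** [ideal_pi] intertwines the actions of [a] and [pi a], hence so does its adjoint, which carries
    the Leibniz rule over. *)
Lemma derivation_lift (D : quotient_alg I -> dual_space (ideal_elt K)) :
  derivation D -> derivation (ideal_pi_dual \o D \o pi).
Proof.
move=> [Dl Dc DM]; split=> [k a b|a|a b] /=.
- by rewrite quotient_pi_linear Dl; exact: dual_pullback_linear.
- apply: continuous_comp; first exact: quotient_pi_continuous.
  apply: continuous_comp; first exact: Dc.
  apply: contraction_continuous; first exact: dual_pullback_linear.
  exact: dual_pullback_norm_le.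
- apply: dualP => x; rewrite quotient_piM DM.
  (* The dual actions are unfolded at [x]: acting on a functional from one side multiplies its
     argument on the other. *)
  rewrite -[RHS]/(D (pi b) (ideal_pi (ract x a)) + D (pi a) (ideal_pi (lact b x))).
  by rewrite ideal_pi_ract ideal_pi_lact.
Qed.

End preimage_ideal.

Section ideal_inclusion.
Context {R : realType} {A : banachAlgType R[i]}.

Lemma dual_restrict (J : closedIdeal A) (f : dual_space (regular_bimod A)) :
  exists g : dual_space (ideal_elt J), forall x, g x = f (val x).
Proof.
have vl : linear (val : ideal_elt J -> regular_bimod A) by [].
have v1 (x : ideal_elt J) : `|val x : regular_bimod A| <= `|x| by [].
by exists (dual_pullback vl v1 f).
Qed.

(** Comparing elements of I and J through [val] spares users any explicit embedding of I in J. *)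
Lemma dual_restrict_ideal (I J : closedIdeal A) (m : dual_space (ideal_elt J)) :
  {subset I <= J} -> exists g : dual_space (ideal_elt I),
    forall x y, val x = val y -> g x = m y.
Proof.
move=> IJ; pose i (x : ideal_elt I) : ideal_elt J := IdealElt (IJ _ (valP x)).
have il : linear i by move=> k x y; apply: val_inj.
have i1 x : `|i x| <= `|x| by [].
exists (dual_pullback il i1 m) => x y xy /=.
by congr (m _); apply: val_inj.
Qed.

End ideal_inclusion.

Theorem theorem1p12 (R : realType) (A : banachAlgType R[i])
    (I : closedIdeal A)
    (amenA : ideally_amenable A)
    (traceI : trace_extension_property I) :
  ideally_amenable (quotient_alg I).
Proof.
move=> K D /[dup] derD /derivation_lift /amenA [m mD].
have DE a x : D (quotient_pi I a) (ideal_pi x) = m (ract x a) - m (lact a x).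
  by have /(congr1 (fun g : dual_space _ => g x)) := mD a.
have IJ : {subset I <= preimage_ideal K}.
  by move=> x /(quotient_pi0P I x) x0; rewrite inE x0 rpred0.
have [mI mIE] := dual_restrict_ideal m IJ.
have mI_trace a : lact a mI = ract mI a.
  apply: dualP => x; pose y := IdealElt (IJ _ (valP x)).
  rewrite lact_dualE ract_dualE (mIE _ (ract y a))// (mIE _ (lact a y))//.
  (* By [DE] the trace defect of [m] at [y] is a value of [D] at [ideal_pi y], which is zero as [y]
     comes from I. *)
  apply/eqP; rewrite -subr_eq0 -DE.
  suff -> : ideal_pi y = 0 by rewrite linear0.
  by apply: val_inj; apply/quotient_pi0P; exact: valP x.
have [f fm f_trace] := traceI mI mI_trace.
have [g gE] := dual_restrict (preimage_ideal K : closedIdeal A) f.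
have gC a x : g (ract x a) = g (lact a x).
  by rewrite !gE; have /(congr1 (fun h : dual_space _ => h (val x))) := f_trace a.
(* The kernel of [ideal_pi] consists of the elements of I, where [g], [f], [mI] and [m] all
   agree. *)
have [x x0|n nE] := @dual_descend _ _ _ _ (m - g).
  have xI : val x \in I by apply/quotient_pi0P; exact: (congr1 val x0).
  by rewrite -[LHS]/(m x - g x) gE -(mIE (IdealElt xI))// -fm subrr.
exists n => q; apply: dualP => p.
have [a <-] := quotient_piP q; have [b bp] := quotient_piP (val p).
have [x _ <-] := ideal_piP bp.
rewrite DE -[RHS]/(n (ract _ _) - n (lact _ _)) -ideal_pi_ract -ideal_pi_lact.
(* By [gC] the two [g] terms are equal and cancel, leaving the expression found in [DE]. *)
rewrite !nE -[RHS]/((m _ - g _) - (m _ - g _)) gC.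
by rewrite opprB addrA subrK.
Qed.
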